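(* Let $\mathbf P=(P,\leq,{}',0,1)$ be an orthogonal poset. Then $\mathbf P$ is orthomodular if and only if it does not contain an orthogonal subposet isomorphic to $\mathbf O_6$.
   Context: An orthoposet is a tuple $(P,\leq,{}',0,1)$ where $(P,\leq,0,1)$ is a bounded poset and ${}'$ is a unary operation on $P$ such that $x\leq y$ implies $y'\leq x'$, $x''=x$, and for every $x$ the supremum $x\vee x'$ exists and equals $1$ and the infimum $x\wedge x'$ exists and equals $0$. Elements $x,y$ are orthogonal, $x\perp y$, if $x\leq y'$. An orthogonal poset is an orthoposet in which the supremum $x\vee y$ exists whenever $x\perp y$. An orthogonal poset is orthomodular if $x\leq y$ implies $x\vee(x\vee y')'=y$. $\mathbf O_6=(\{0,a,b,a',b',1\},\leq,{}',0,1)$ is the six-element orthogonal poset (in fact ortholattice) with $0<a<b<1$ and $0<b'<a'<1$ and no other order relations except those implied by reflexivity and transitivity, where ${}'$ interchanges $0$ with $1$, $a$ with $a'$ and $b$ with $b'$. An orthogonal subposet of an orthogonal poset $\mathbf P$ is a subset $S\subseteq P$ with $0,1\in S$, closed under ${}'$, and such that $x\vee y$ (supremum in $\mathbf P$) belongs to $S$ whenever $x,y\in S$ and $x\perp y$; it carries the induced order and the restricted operation ${}'$. Isomorphisms are order isomorphisms preserving ${}'$ (and hence $0,1$). *)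

(* Defs.v *)
From HB Require Import structures.
From mathcomp Require Import all_boot all_order.
From mathcomp Require Import boolp classical_sets functions.

Set Implicit Arguments.
Unset Strict Implicit.
Unset Printing Implicit Defensive.

Import Order.Theory.
Local Open Scope classical_set_scope.
Local Open Scope order_scope.

HB.mixin Record TBPOrder_isOrthoposet d T of Order.TBPOrder d T := {
  ortho : T -> T;
  ortho_anti : forall x y : T, x <= y -> ortho y <= ortho x;
  orthoK : involutive ortho;
  supremums_ortho : forall x : T, supremums [set x; ortho x] \top;
  infimums_ortho : forall x : T, infimums [set x; ortho x] \bot }.

#[short(type="orthoposetType")]
HB.structure Definition Orthoposet d :=
  { T of TBPOrder_isOrthoposet d T & Order.TBPOrder d T }.

Definition perp d (P : orthoposetType d) (x y : P) : bool := x <= ortho y.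

HB.mixin Record Orthoposet_isOrthogonal d T of Orthoposet d T := {
  perp_supremums : forall x y : T, perp x y -> supremums [set x; y] !=set0 }.

#[short(type="orthogonalPosetType")]
HB.structure Definition OrthogonalPoset d :=
  { T of Orthoposet_isOrthogonal d T & Orthoposet d T }.

(* The supremum of x and y when it exists. The default value \bot is irrelevant
   below, where sup2 is only applied to orthogonal elements: if x <= y, then
   x is orthogonal to ortho y and to the complement of sup2 x (ortho y). *)
Definition sup2 d (P : orthogonalPosetType d) (x y : P) : P :=
  supremum \bot [set x; y].

Definition orthomodular d (P : orthogonalPosetType d) : Prop :=
  forall x y : P, x <= y -> sup2 x (ortho (sup2 x (ortho y))) = y.

Definition orthogonal_subposet d (P : orthogonalPosetType d) (S : set P) :
    Prop :=
  [/\ S \bot, S \top, forall x, S x -> S (ortho x) &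
      forall x y, S x -> S y -> perp x y -> S (sup2 x y)].

(* f is an isomorphism from Q onto S, where S carries the order and the
   orthocomplementation of P *)
Definition iso_onto d d' (Q : orthogonalPosetType d)
    (P : orthogonalPosetType d') (S : set P) (f : Q -> P) : Prop :=
  [/\ set_bij [set: Q] S f, {mono f : x y / x <= y} &
      {morph f : x / ortho x}].

Variant O6 := O6_0 | O6_a | O6_b | O6_a' | O6_b' | O6_1.

Definition O6_code (x : O6) : 'I_6 :=
  match x with
  | O6_0 => inord 0 | O6_a => inord 1 | O6_b => inord 2
  | O6_a' => inord 3 | O6_b' => inord 4 | O6_1 => inord 5
  end.

Definition O6_decode (i : 'I_6) : O6 :=
  nth O6_0 [:: O6_0; O6_a; O6_b; O6_a'; O6_b'; O6_1] i.

Lemma O6_codeK : cancel O6_code O6_decode.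
Proof. by case; rewrite /O6_decode inordK. Qed.

HB.instance Definition _ := Finite.copy O6 (can_type O6_codeK).

Definition O6_le (x y : O6) : bool :=
  match x, y with
  | O6_0, _ | _, O6_1 => true
  | O6_a, (O6_a | O6_b) => true
  | O6_b, O6_b => true
  | O6_b', (O6_b' | O6_a') => true
  | O6_a', O6_a' => true
  | O6_1, _ | _, O6_0 => false
  | _, _ => false
  end.

Definition O6_ortho (x : O6) : O6 :=
  match x with
  | O6_0 => O6_1 | O6_1 => O6_0
  | O6_a => O6_a' | O6_a' => O6_a
  | O6_b => O6_b' | O6_b' => O6_b
  end.

Fact O6_display : Order.disp_t. Proof. exact: Order.Disp tt tt. Qed.

Fact O6_le_refl : reflexive O6_le. Proof. by case. Qed.
Fact O6_le_anti : antisymmetric O6_le. Proof. by do 2!case. Qed.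
Fact O6_le_trans : transitive O6_le. Proof. by do 3!case. Qed.

HB.instance Definition _ := Order.Le_isPOrder.Build O6_display O6
  O6_le_refl O6_le_anti O6_le_trans.

Fact O6_le0x (x : O6) : O6_0 <= x. Proof. by case: x. Qed.
Fact O6_lex1 (x : O6) : x <= O6_1. Proof. by case: x. Qed.

HB.instance Definition _ := Order.hasBottom.Build O6_display O6 O6_le0x.
HB.instance Definition _ := Order.hasTop.Build O6_display O6 O6_lex1.

Lemma supremums2P d (T : porderType d) (x y z : T) :
  supremums [set x; y] z <->
  [/\ x <= z, y <= z & forall t, x <= t -> y <= t -> z <= t].
Proof.
split=> [[u l]|[xz yz l]]; last first.
  by split=> [t [->|->] //|t u]; apply: l; apply: u; [left|right].
split; [by apply: u; left|by apply: u; right|].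
by move=> t xt yt; apply: l => s [->|->].
Qed.

Lemma infimums2P d (T : porderType d) (x y z : T) :
  infimums [set x; y] z <->
  [/\ z <= x, z <= y & forall t, t <= x -> t <= y -> t <= z].
Proof.
split=> [[u l]|[xz yz l]]; last first.
  by split=> [t [->|->] //|t u]; apply: l; apply: u; [left|right].
split; [by apply: u; left|by apply: u; right|].
by move=> t xt yt; apply: l => s [->|->].
Qed.

Fact O6_ortho_anti (x y : O6) : x <= y -> O6_ortho y <= O6_ortho x.
Proof. by case: x y => -[]. Qed.

Fact O6_orthoK : involutive O6_ortho. Proof. by case. Qed.

Fact O6_supremums_ortho (x : O6) : supremums [set x; O6_ortho x] \top.
Proof. by apply/supremums2P; split; [case: x..|case: x => -[]]. Qed.

Fact O6_infimums_ortho (x : O6) : infimums [set x; O6_ortho x] \bot.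
Proof. by apply/infimums2P; split; [case: x..|case: x => -[]]. Qed.

HB.instance Definition _ := TBPOrder_isOrthoposet.Build O6_display O6
  O6_ortho_anti O6_orthoK O6_supremums_ortho O6_infimums_ortho.

Fact O6_perp_supremums (x y : O6) : perp x y -> supremums [set x; y] !=set0.
Proof.
move=> xy; exists (if x <= y then y else if y <= x then x else \top).
by apply/supremums2P; split; case: x y xy => -[] //= _; case.
Qed.

HB.instance Definition _ := Orthoposet_isOrthogonal.Build O6_display O6
  O6_perp_supremums.

(* Main.v *)
(* If f embeds O6 in P, then the supremum of f a and (f b)' is 1, so the
   orthomodular law at f a <= f b would give f a = f b. Conversely, if it fails
   at x <= y, put z = x \/ (x \/ y')': then z < y, and z \/ y' = 1 because an
   upper bound of z and y' lies above both x \/ y' and its orthocomplement; so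
   {0, z, y, z', y', 1} is a copy of O6. *)
Require Import Defs.
From HB Require Import structures.
From mathcomp Require Import all_boot all_order.
From mathcomp Require Import boolp classical_sets functions.

Set Implicit Arguments.
Unset Strict Implicit.
Unset Printing Implicit Defensive.

Import Order.Theory.
Local Open Scope classical_set_scope.
Local Open Scope order_scope.

Section Orthogonal.
Context {d : Order.disp_t} {P : orthogonalPosetType d}.
Implicit Types x y z t : P.

Lemma ortho_le x y : (ortho x <= ortho y) = (y <= x).
Proof. by apply/idP/idP => /ortho_anti; rewrite ?orthoK. Qed.

Lemma ortho_top : ortho \top = \bot :> P.
Proof. by apply/le_anti; rewrite le0x -[\bot]orthoK ortho_le lex1. Qed.

Lemma ortho_bot : ortho \bot = \top :> P.
Proof. by rewrite -ortho_top orthoK. Qed.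

Lemma le_ortho_eq_top x t : x <= t -> ortho x <= t -> t = \top.
Proof.
move=> xt x't; apply/le_anti; rewrite lex1 /=.
by have /supremums2P[_ _] := supremums_ortho x; apply.
Qed.

(** A supremum is unique by antisymmetry, so the choice made by [supremum] can only be [z]; its
    default for the empty set is ruled out because [x] is in the pair. *)
Lemma sup2E x y z : supremums [set x; y] z -> sup2 x y = z.
Proof.
move=> sz; rewrite /sup2 /supremum; case: ifPn => [/eqP e|_].
  by have : [set x; y] x by [left]; rewrite e.
by case: xgetP => [t _ /is_subset1_supremums|/(_ z)//]; apply.
Qed.

Lemma sup2P x y : perp x y -> supremums [set x; y] (sup2 x y).
Proof. by move=> /perp_supremums[z sz]; rewrite (sup2E sz). Qed.

Lemma sup2_r x y : x <= y -> sup2 x y = y.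
Proof. by move=> xy; apply/sup2E/supremums2P; split. Qed.

Lemma sup2_l x y : y <= x -> sup2 x y = x.
Proof. by move=> yx; apply/sup2E/supremums2P; split. Qed.

Lemma sup2_eq_top x y :
  (forall t, x <= t -> y <= t -> t = \top) -> sup2 x y = \top.
Proof.
move=> h; apply/sup2E/supremums2P; split; rewrite ?lex1// => t xt yt.
by rewrite (h t).
Qed.

Definition O6_map x y (u : O6) : P :=
  match u with
  | O6_0 => \bot | O6_a => x | O6_b => y
  | O6_a' => ortho x | O6_b' => ortho y | O6_1 => \top
  end.

Section Copy.
Context {x y : P}.
(** The second hypothesis expresses [x \/ y' = 1] through upper bounds, ready to be applied to any
    candidate bound. *)
Hypotheses (xy : x < y)
  (xy'_top : forall t, x <= t -> ortho y <= t -> t = \top).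

Local Notation f := (O6_map x y).

Lemma O6_map_ortho : {morph f : u / ortho u}.
Proof. by case; rewrite /= ?orthoK ?ortho_top ?ortho_bot. Qed.

Lemma O6_map_mono : {mono f : u v / u <= v}.
Proof.
have xley := ltW xy.
have yNx : ~~ (y <= x) by rewrite lt_geF.
have y'x' : ortho y <= ortho x by rewrite ortho_le.
(* If [y = 1], then [y' = 0] and [x] itself bounds [x] and [y'], so [x = 1 = y]. Dually, [x = 0]
   would make [y'] such a bound, giving [y' = 1] and [y = 0 = x]. *)
have yN1 : y <> \top.
  move=> y1; move: xy; rewrite (@xy'_top x) ?y1 ?ltxx//.
  by rewrite ortho_top le0x.
have xN0 : x <> \bot.
  move=> x0; have /(congr1 ortho) : ortho y = \top.
    by apply: xy'_top; rewrite // x0 le0x.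
  by rewrite orthoK ortho_top -x0 => e; move: xy; rewrite e ltxx.
have yN0 : y <> \bot by move=> y0; move: xy; rewrite y0 ltx0.
have xN1 : x <> \top by move=> x1; move: xy; rewrite x1 lt1x.
(* Each remaining comparison would put some element above both an element and its complement,
   forcing the value 1, or reduces to such a case by transitivity. *)
have x'Ny : ~~ (ortho x <= y).
  by apply/negP => h; apply/yN1/(le_ortho_eq_top xley h).
have yNx' : ~~ (y <= ortho x).
  apply/negP => h; apply: xN0; rewrite -[x]orthoK -ortho_top; congr ortho.
  by apply: (@le_ortho_eq_top x); rewrite // (le_trans xley h).
have eqN z : z <> \top -> ortho z <> \bot.
  by move=> zN e; apply: zN; rewrite -[z]orthoK e ortho_bot.
have eqN' z : z <> \bot -> ortho z <> \top.
  by move=> zN e; apply: zN; rewrite -[z]orthoK e ortho_top.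
have xNx' : ~~ (x <= ortho x).
  apply/negP => h; apply: (eqN' _ xN0); exact: (le_ortho_eq_top h).
have x'Nx : ~~ (ortho x <= x).
  by apply/negP => h; move: x'Ny; rewrite (le_trans h).
have yNy' : ~~ (y <= ortho y).
  by apply/negP => h; move: yNx'; rewrite (le_trans h).
have xNy' : ~~ (x <= ortho y).
  by apply/negP => h; move: xNx'; rewrite (le_trans h).
have y'Ny : ~~ (ortho y <= y).
  by apply/negP => h; apply/yN1/(@le_ortho_eq_top y).
have y'Nx : ~~ (ortho y <= x).
  by apply/negP => h; move: y'Ny; rewrite (le_trans h).
have top_bot : (\top : P) <> \bot.
  by move=> e; apply: xN0; apply/le_anti; rewrite le0x -e lex1.
case=> -[] /=; rewrite ?lexx ?le0x ?lex1 ?(@lex0 _ P) ?(@le1x _ P) ?ortho_le //;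
  by apply/negbTE => //; apply/eqP; auto.
Qed.

(** The only incomparable orthogonal pairs in [O6] are [{a, a'}], [{b, b'}] and [{a, b'}]. The first
    two have supremum 1 by complementation, the third by [xy'_top]. *)
Lemma O6_map_sup2 u v : perp u v ->
  sup2 (f u) (f v) = f (if u <= v then v else if v <= u then u else \top).
Proof.
move=> uv; case: ifPn => [|uNv]; first by rewrite -O6_map_mono => /sup2_r.
case: ifPn => [|vNu]; first by rewrite -O6_map_mono => /sup2_l.
case: u v uv uNv vNu => -[] //= _ _ _; apply: sup2_eq_top => t ut vt;
  do ?[exact: xy'_top | exact: (le_ortho_eq_top ut)
      | exact: (le_ortho_eq_top vt)].
Qed.

Lemma O6_map_subposet : orthogonal_subposet (range f).
Proof.
split; [by exists O6_0|by exists O6_1| |].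
  by move=> _ [u _ <-]; exists (ortho u); rewrite ?O6_map_ortho.
(* Orthogonality in [P] pulls back to [O6], since the map commutes with complements and reflects the
   order. *)
move=> _ _ [u _ <-] [v _ <-]; rewrite /perp -O6_map_ortho O6_map_mono => uv.
by rewrite O6_map_sup2//; eexists.
Qed.

Lemma O6_map_iso : iso_onto (range f) f.
Proof.
split; [|exact: O6_map_mono|exact: O6_map_ortho].
split; [by move=> u uT; exists u|by move=> u v _ _ /(inc_inj O6_map_mono)|].
exact: subset_refl.
Qed.

End Copy.

Lemma orthomodular_no_O6 (S : set P) (f : O6 -> P) :
  orthomodular P -> orthogonal_subposet S -> ~ iso_onto S f.
Proof.
move=> om [S0 S1 _ Ssup] [[fS finj fsurj] fmono fortho].
have ab : f O6_a <= f O6_b by rewrite fmono.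
have pab : perp (f O6_a) (ortho (f O6_b)) by rewrite /perp orthoK.
have f1 : f O6_1 = \top.
  have [u _ fu] := fsurj _ S1.
  by apply/le_anti; rewrite lex1 -fu fmono lex1.
(* Closure of [S] puts this supremum, taken in [P], in the image of [f]; its preimage lies above [a]
   and [b'], and only the top of [O6] does. *)
have /fsurj[u _ fu] : S (sup2 (f O6_a) (ortho (f O6_b))).
  by apply: Ssup => //; rewrite -?fortho; exact: fS.
have /supremums2P[] := sup2P pab; rewrite -fu -fortho !fmono => au b'u _.
have {au b'u} u1 : u = O6_1 by case: u au b'u {fu}.
(* The law now reads [f a \/ 0 = f b], and injectivity would identify [a] with [b]. *)
have := om _ _ ab; rewrite -fu u1 f1 ortho_top sup2_l ?le0x// => /finj.
by rewrite !in_setT => /(_ isT isT).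
Qed.

Lemma not_orthomodular_pair : ~ orthomodular P ->
  exists x y, x < y /\ forall t, x <= t -> ortho y <= t -> t = \top.
Proof.
move=> /existsNP[x /existsNP[y /not_implyP[xy zNy]]].
have /sup2P/supremums2P[] : perp x (ortho y) by rewrite /perp orthoK.
set w := sup2 x (ortho y) in zNy * => xw y'w wl.
have /sup2P/supremums2P[] : perp x (ortho w) by rewrite /perp orthoK.
set z := sup2 x (ortho w) in zNy * => xz w'z zl.
exists z, y; split=> [|t zt y't].
  rewrite lt_neqAle; apply/andP; split; first exact/eqP.
  (* [y] bounds both [x] and [w'], the latter because [y' <= w]. *)
  by apply: zl; rewrite // -[y]orthoK ortho_le.
apply: (@le_ortho_eq_top w); last exact: le_trans zt.
by apply: wl => //; exact: le_trans zt.
Qed.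

End Orthogonal.

Theorem proposition3p3 (d : Order.disp_t) (P : orthogonalPosetType d) :
  orthomodular P <->
  ~ exists S : set P, orthogonal_subposet S /\
      exists f : O6 -> P, iso_onto S f.
Proof.
split=> [om [S [sS [f]]]|noO6]; first exact: orthomodular_no_O6.
apply: contrapT => /not_orthomodular_pair[x [y [xy xy'_top]]].
apply: noO6; exists (range (O6_map x y)); split.
  exact: O6_map_subposet.
by exists (O6_map x y); exact: O6_map_iso.
Qed.
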